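(* Let $l>1$ be an integer, let $e_1,\dots,e_{l+1}$ and $o_1,\dots,o_l$ be positive integers, and let $n$ and $W$ be positive rational numbers such that $$(E^{e_1}\circ O^{o_1}\circ E^{e_2}\circ\dotsb\circ O^{o_l}\circ E^{e_{l+1}})(n)=W.$$ Let $\sigma_e=e_1+\dots+e_{l+1}$ and $\sigma_o=o_1+\dots+o_l$. Then $$(E^{e_1}\circ O^{o_1}\circ E^{e_2}\circ\dotsb\circ O^{o_l}\circ E^{e_{l+1}})(n)=(E^{\sigma_e}\circ O^{\sigma_o})(n)+C=W,$$ where $C$ (the number determined by this equation) satisfies $0<C<W$.
   Context: $E$ and $O$ are the functions $E(n)=n/2$ and $O(n)=(3n+1)/2$ on positive rational numbers. Exponents on functions denote repeated composition ($E^k=E\circ\dotsb\circ E$, $k$ times), and $(A\circ B)(n)=A(B(n))$. The composition in the claim alternates $E^{e_i}$ and $O^{o_i}$ for $i=1,\dots,l$ from left to right and ends with $E^{e_{l+1}}$ on the right (which is applied first). *)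

(* Defs.v *)
From mathcomp Require Import all_boot all_order all_algebra.

Set Implicit Arguments.
Unset Strict Implicit.
Unset Printing Implicit Defensive.

Import Order.TTheory GRing.Theory Num.Theory.
Local Open Scope ring_scope.

(* Both maps send positive rationals to positive rationals; they are given
   here on all of [rat], and are only ever applied to positive arguments. *)
Definition E (n : rat) : rat := n / 2.
Definition O (n : rat) : rat := (3 * n + 1) / 2.

Definition fcomp (A B : rat -> rat) : rat -> rat := A \o B.

(* [\big] over an interval folds to the right, so the factor of index 1 is
   the leftmost (outermost) one. Indices are 1-based: only e 1, ..., e l.+1
   and o 1, ..., o l are used. *)
Definition alternating (l : nat) (e o : nat -> nat) : rat -> rat :=
  (\big[fcomp/id]_(1 <= i < l.+1) (iter (e i) E \o iter (o i) O))
    \o iter (e l.+1) E.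

(* Main.v *)
Require Import Defs.
From mathcomp Require Import all_boot all_order all_algebra.
From mathcomp Require Import ring lra.
Import Order.TTheory GRing.Theory Num.Theory.
Local Open Scope ring_scope.

(** Since [O (E x) - E (O x) = 1/4 > 0] and both maps are increasing, moving all
    the divisions [E] to the left of all the [O] strictly decreases the value;
    [C] is the total decrease, and [C < W] because the sorted composition is
    positive on positive rationals. *)

Lemma iterE (k : nat) (x : rat) : iter k E x = x / 2 ^+ k.
Proof.
elim: k => [|k IHk] /=; first by rewrite expr0 divr1.
by rewrite IHk /E exprSr invfM mulrA.
Qed.

(* [O] is the scaling by [3/2] about its fixed point [-1]. *)
Lemma iterO (k : nat) (x : rat) : iter k O x = (3 / 2) ^+ k * (x + 1) - 1.
Proof.
elim: k => [|k IHk] /=; first by rewrite expr0 mul1r addrK.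
by rewrite IHk /O exprS; field.
Qed.

Lemma iterE_homo (k : nat) : {homo iter k E : x y / x <= y}.
Proof. by move=> x y le_xy; rewrite !iterE ler_wpM2r // invr_ge0 exprn_ge0. Qed.

Lemma iterE_homo_lt (k : nat) : {homo iter k E : x y / x < y}.
Proof. by move=> x y lt_xy; rewrite !iterE ltr_pM2r // invr_gt0 exprn_gt0. Qed.

Lemma iterO_homo (k : nat) : {homo iter k O : x y / x <= y}.
Proof. by move=> x y le_xy; rewrite !iterO lerD2r ler_wpM2l ?exprn_ge0 ?lerD2r. Qed.

Lemma iterE_gt0 (k : nat) (x : rat) : 0 < x -> 0 < iter k E x.
Proof. by move=> x_gt0; rewrite iterE divr_gt0 ?exprn_gt0. Qed.

Lemma iterO_gt0 (k : nat) (x : rat) : 0 < x -> 0 < iter k O x.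
Proof. by move=> x_gt0; elim: k => //= k; rewrite /O; lra. Qed.

(** Both compositions are affine with the same slope [(3/2)^k / 2^j], so their difference is a
    constant independent of [x]. *)
Lemma iterOE_subr (j k : nat) (x : rat) :
  iter k O (iter j E x) - iter j E (iter k O x)
    = ((3 / 2) ^+ k - 1) * (1 - (2 ^+ j)^-1).
Proof. by rewrite !iterE !iterO; ring. Qed.

Lemma iterEO_le (j k : nat) (x : rat) :
  iter j E (iter k O x) <= iter k O (iter j E x).
Proof.
rewrite -subr_ge0 iterOE_subr mulr_ge0 // subr_ge0 ?exprn_ege1 //.
by rewrite invf_le1 ?exprn_gt0 ?exprn_ege1.
Qed.

Lemma iterEO_lt (j k : nat) (x : rat) : (0 < j)%N -> (0 < k)%N ->
  iter j E (iter k O x) < iter k O (iter j E x).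
Proof.
move=> j_gt0 k_gt0; rewrite -subr_gt0 iterOE_subr mulr_gt0 // subr_gt0.
  by rewrite exprn_egt1 // -lt0n.
by rewrite invf_lt1 ?exprn_gt0 // exprn_egt1 // -lt0n.
Qed.

(** Induction on the blocks: once the tail is sorted, its divisions are moved left past the [O]s of
    the head block. Equality holds for empty [s], so only a weak inequality is claimed. *)
Lemma sorted_le_big_fcomp (s : seq nat) (e o : nat -> nat) (x : rat) :
  iter (\sum_(i <- s) e i)%N E (iter (\sum_(i <- s) o i)%N O x)
    <= (\big[fcomp/id]_(i <- s) (iter (e i) E \o iter (o i) O)) x.
Proof.
elim: s => [|i s IHs]; first by rewrite !big_nil.
rewrite !big_cons /fcomp /= !iterD; apply: iterE_homo.
exact: le_trans (iterEO_le _ _ _) (iterO_homo _ _ _ IHs).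
Qed.

Theorem theorem1 (l : nat) (e o : nat -> nat) (n W : rat)
    (hl : (1 < l)%N)
    (he : forall i : nat, (1 <= i <= l.+1)%N -> (0 < e i)%N)
    (ho : forall i : nat, (1 <= i <= l)%N -> (0 < o i)%N)
    (hn : 0 < n) (hW : 0 < W)
    (hcomp : alternating l e o n = W) :
  let sigma_e := (\sum_(1 <= i < l.+2) e i)%N in
  let sigma_o := (\sum_(1 <= i < l.+1) o i)%N in
  exists C : rat,
    [/\ alternating l e o n = (iter sigma_e E \o iter sigma_o O) n + C,
        (iter sigma_e E \o iter sigma_o O) n + C = W
      & 0 < C < W].
Proof.
move=> sigma_e sigma_o; set S := (iter sigma_e E \o iter sigma_o O) n.
exists (W - S); rewrite hcomp [S + _]addrC subrK; split=> //.
have S_gt0 : 0 < S by apply/iterE_gt0/iterO_gt0.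
rewrite subr_gt0 ltrBlDr ltrDl S_gt0 andbT -hcomp /S /alternating /=.
(* Sort the first [l] blocks, evaluated at [iter (e l.+1) E n]. *)
apply: lt_le_trans (sorted_le_big_fcomp _ _ _ _).
(* Strictness comes from moving the innermost block, of exponent [e l.+1], across all [sigma_o]
   copies of [O]. *)
rewrite /sigma_e big_nat_recr //= iterD; apply/iterE_homo_lt/iterEO_lt.
  by apply: he; rewrite leqnn.
have l_gt0 : (0 < l)%N by exact: ltnW hl.
(* The summand [o 1] already makes [sigma_o] positive. *)
by rewrite /sigma_o big_ltn // ltn_addr // ho.
Qed.
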